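(* Fix $\alpha\in(0,1)$, $\sigma>0$, $\kappa>0$, a positive sequence $C_n\to\infty$ (used in the definition of the confusion set), dimensions $d=d_n\ge 2$ that may vary arbitrarily with $n$, and an index $r\in[d]$. For any $\tau\in\{0,1,\dots,d-2\}$ (possibly depending on $n$), suppose that $\varepsilon=\varepsilon_n\ge C_n'\varepsilon^\star(\tau)$, where $C_n'$ is any positive sequence with $C_n'\to\infty$ as $n\to\infty$ and $$\varepsilon^\star(\tau)=\sqrt{\frac{1\vee\log\tau}{n}}.$$ Then, for $\widehat s=\widehat s_{\mathrm{plug}}$ and for $\widehat s=\widehat s_{\mathrm{adj}}$, the DA argmin test has asymptotic uniform power one: $$\lim_{n\to\infty}\ \inf_{P\in\mathcal{P}_{1,r}(\varepsilon;\tau)}P\Bigl(\sqrt n\,\bm\gamma_{\widehat s}^\top\overline{\bm X}^{(1)}>z_{1-\alpha}\sqrt{\bm\gamma_{\widehat s}^\top\widehat{\bm\Sigma}^{(1)}\bm\gamma_{\widehat s}}\Bigr)=1 .$$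
   Context: Notation: $[d]=\{1,\dots,d\}$; $\bm X_1,\dots,\bm X_{2n}$ are i.i.d. from $P$ on $\mathbb{R}^d$ with mean $\bm\mu=(\mu_1,\dots,\mu_d)^\top$; $z_{1-\alpha}$ is the $1-\alpha$ standard normal quantile; $a\vee b=\max(a,b)$, and $1\vee\log 0=1$; $\bm\gamma_k=\bm e_r-\bm e_k$ with $\bm e_k$ the standard basis vectors. ''sargmin'' is the smallest index attaining the minimum. An infimum over an empty class is taken to be $1$. $\overline{\bm X}^{(1)}$, $\widehat{\bm\Sigma}^{(1)}$ are the sample mean and sample covariance matrix of $\bm X_1,\dots,\bm X_n$, and $\overline{\bm X}^{(2)}$, $\widehat{\bm\Sigma}^{(2)}$ those of $\bm X_{n+1},\dots,\bm X_{2n}$. Selection rules, with $\kappa>0$ a fixed constant: $$\widehat s_{\mathrm{plug}}=\mathop{\mathrm{sargmin}}_{k\in[d]\setminus\{r\}}\overline X^{(2)}_k,\qquad \widehat s_{\mathrm{adj}}=\mathop{\mathrm{sargmin}}_{k\in[d]\setminus\{r\}}\frac{\overline X^{(2)}_k-\overline X^{(2)}_r}{\sqrt{\bm\gamma_k^\top\widehat{\bm\Sigma}^{(2)}\bm\gamma_k}\vee\kappa}.$$ Let $\mu_\star=\min_{k\in[d]}\mu_k$ and $\Theta_{-r}=\arg\min_{k\in[d]\setminus\{r\}}\mu_k$ (set of all minimizers). The confusion set is $$\mathbb{C}_r=\Bigl\{k\in[d]\setminus(\{r\}\cup\Theta_{-r}):\ \tfrac{\mu_r-\mu_\star}{2}\le\mu_k-\mu_\star\le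 C_n\sqrt{\tfrac{\log d}{n}}\Bigr\}.$$ $\mathcal{P}$ is the class of distributions on $\mathbb{R}^d$ that are sub-Gaussian with variance proxy $\sigma^2$: $\mathbb{E}_P[\exp(\lambda\langle\bm v,\bm X-\bm\mu\rangle)]\le\exp(\lambda^2\sigma^2/2)$ for all $\lambda\in\mathbb{R}$ and all unit vectors $\bm v$. For $\varepsilon>0$, $$\mathcal{P}_{1,r}(\varepsilon;\tau)=\{P\in\mathcal{P}:\ \mu_r-\mu_\star\ge\varepsilon\ \text{and}\ |\mathbb{C}_r|=\tau\}.$$ *)

(* Defs.v *)
From HB Require Import structures.
From mathcomp Require Export all_boot all_order all_algebra.
From mathcomp Require Export all_classical all_reals all_analysis.
Set Implicit Arguments.
Unset Strict Implicit.
Unset Printing Implicit Defensive.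
Export Order.TTheory GRing.Theory Num.Theory.
Export numFieldNormedType.Exports.

#[global] Open Scope classical_set_scope.
#[global] Open Scope ring_scope.

(* The product measure is built by recursion, as the image of
   P \x P^n under (x, t) |-> x :: t; [iid_box] is its characterization. *)
Section iid.
Context (d : measure_display) (T : measurableType d) (R : realType).

Definition tuple_cons n (x : T * n.-tuple T) : n.+1.-tuple T :=
  [the n.+1.-tuple T of x.1 :: x.2].

Lemma measurable_tuple_cons n : measurable_fun setT (@tuple_cons n).
Proof. exact: measurable_cons. Qed.

HB.instance Definition _ n :=
  isMeasurableFun.Build _ _ _ _ (@tuple_cons n) (@measurable_tuple_cons n).

Fixpoint iid (P : probability T R) n : probability (n.-tuple T) R :=
  match n with
  | 0 => dirac (nil_tuple T)
  | n'.+1 => distribution (P \x iid P n')%E (@tuple_cons n')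
  end.

Lemma iid_box (P : probability T R) n (A : 'I_n -> set T) :
  (forall i, measurable (A i)) ->
  iid P n [set t | forall i, A i (tnth t i)] = (\prod_(i < n) P (A i))%E.
Proof.
elim: n A => [|n IHn] A mA /=.
  rewrite big_ord0 diracE mem_set//= => i; by case: i.
rewrite big_ord_recl -IHn// /distribution /pushforward.
rewrite -product_measure1E//.
- congr (product_measure1 _ _ _); apply/seteqP; split => -[x t] /=.
    move=> h; split; first by have := h ord0.
    by move=> i; have := h (lift ord0 i); rewrite tnthS.
  move=> [hx ht] i; have [j ->|->] := unliftP ord0 i; last by [].
  by rewrite tnthS.
- rewrite (_ : mkset _ =
    \bigcap_(i in [set: 'I_n]) ((fun t => tnth t i) @^-1` A (lift ord0 i))).
    apply: fin_bigcap_measurable => // i _; rewrite -[X in measurable X]setTI.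
    exact: measurable_tnth.
  by apply/seteqP; split => t /= h i; [move=> _|]; exact: h.
Qed.

End iid.

(* A point of R^d is a d.-tuple R, whose sigma-algebra is the product (Borel)
   one; [colv] gives the corresponding column vector. *)
Section linear_algebra.
Context (R : realType) (d : nat).
Implicit Types u v : 'cV[R]_d.

Definition colv (x : d.-tuple R) : 'cV[R]_d := \col_k tnth x k.

Definition dotv u v : R := (u^T *m v) 0 0.

Definition qform (S : 'M[R]_d) u : R := (u^T *m S *m u) 0 0.

Definition gammav (r k : 'I_d) : 'cV[R]_d := delta_mx r 0 - delta_mx k 0.

End linear_algebra.

Section sample_statistics.
Context (R : realType) (d n : nat).
Implicit Types X : 'I_n -> 'cV[R]_d.

Definition sample_mean X : 'cV[R]_d := n%:R^-1 *: \sum_(i < n) X i.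

Definition sample_cov X : 'M[R]_d :=
  (n.-1)%:R^-1 *:
    \sum_(i < n) (X i - sample_mean X) *m (X i - sample_mean X)^T.

Definition half1 (w : (n + n).-tuple (d.-tuple R)) (i : 'I_n) : 'cV[R]_d :=
  colv (tnth w (lshift n i)).

Definition half2 (w : (n + n).-tuple (d.-tuple R)) (i : 'I_n) : 'cV[R]_d :=
  colv (tnth w (rshift n i)).

End sample_statistics.

Section argmin.
Context (R : realType) (d : nat) (r : 'I_d) (F : 'I_d -> R).

Definition argmin_except : {set 'I_d} :=
  [set k | k != r & [forall j, (j != r) ==> (F k <= F j)]].

(* The default value r is only reached when d = 1. *)
Definition sargmin_except : 'I_d :=
  odflt r [pick k in argmin_except |
            [forall j in argmin_except, (k <= j)%N]].

End argmin.

Section selection.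
Context (R : realType) (d n : nat).
Implicit Types w : (n + n).-tuple (d.-tuple R).

Definition s_plug (r : 'I_d) w : 'I_d :=
  sargmin_except r (fun k => sample_mean (half2 w) k 0).

Definition s_adj (kappa : R) (r : 'I_d) w : 'I_d :=
  sargmin_except r (fun k =>
    (sample_mean (half2 w) k 0 - sample_mean (half2 w) r 0) /
    Num.max (Num.sqrt (qform (sample_cov (half2 w)) (gammav R r k))) kappa).

End selection.
Arguments s_plug {R d} n r w.
Arguments s_adj {R d} n kappa r w.

(* Quantile function of N(0, 1), as the generalized inverse of its cdf. *)
Definition normal_quantile (R : realType) (p : R) : R :=
  inf [set x : R | (p%:E <= normal_prob 0 1 `]-oo, x])%E].

Definition rejection (R : realType) (d n : nat) (alpha : R) (r : 'I_d)
    (s : (n + n).-tuple (d.-tuple R) -> 'I_d) :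
    set ((n + n).-tuple (d.-tuple R)) :=
  [set w | Num.sqrt n%:R * dotv (gammav R r (s w)) (sample_mean (half1 w)) >
           normal_quantile (1 - alpha) *
           Num.sqrt (qform (sample_cov (half1 w)) (gammav R r (s w)))].

Arguments rejection {R d} n alpha r s _.

Section distribution_classes.
Context (R : realType) (d : nat).
Implicit Types (P : probability (d.-tuple R) R) (r : 'I_d).

Definition meanv P : 'cV[R]_d := \col_k fine 'E_P[fun x => tnth x k].

Definition subgaussian (sigma : R) P : Prop :=
  (forall k, P.-integrable setT (fun x => (tnth x k)%:E)) /\
  forall (lambda : R) (v : 'cV[R]_d), dotv v v = 1 ->
    ('E_P[fun x => expR (lambda * dotv v (colv x - meanv P))] <=
      (expR (lambda ^+ 2 * sigma ^+ 2 / 2))%:E)%E.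

(* The seed of the iterated minimum is one of its terms. *)
Definition mu_min r P : R := \big[Num.min/meanv P r 0]_(k < d) meanv P k 0.

Definition confusion_set (n : nat) (c : R) r P : {set 'I_d} :=
  [set k | [&& k != r, k \notin argmin_except r (fun j => meanv P j 0),
    (meanv P r 0 - mu_min r P) / 2 <= meanv P k 0 - mu_min r P &
    meanv P k 0 - mu_min r P <= c * Num.sqrt (ln d%:R / n%:R)]].

Definition alternatives (n : nat) (sigma c : R) r (eps : R) (tau : nat) :
    set (probability (d.-tuple R) R) :=
  [set P | [/\ subgaussian sigma P, meanv P r 0 - mu_min r P >= eps &
             #|confusion_set n c r P| = tau]].

(* Infimum over the class of the probability of A under the law of m i.i.d.
   draws; equal to 1 on the empty class (where ereal_inf would give +oo). *)
Definition inf_prob (m : nat) (C : set (probability (d.-tuple R) R))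
    (A : set (m.-tuple (d.-tuple R))) : \bar R :=
  if C == set0 then 1%E else ereal_inf [set iid P m A | P in C].

End distribution_classes.

(* ln 0 = 0, so that the maximum is 1 for tau = 0. *)
Definition eps_star (R : realType) (n tau : nat) : R :=
  Num.sqrt (Num.max 1 (ln tau%:R) / n%:R).

(* Main.v *)
From mathcomp Require Import measurable_realfun ring lra.
Require Import Defs.
Set Implicit Arguments.
Unset Strict Implicit.
Unset Printing Implicit Defensive.

(** The two halves of the sample are independent, so the probability of
    acceptance is at most that of selecting a bad index on the right half plus
    the worst probability of acceptance at a good index on the left half.  Both
    rules minimise a score [(mean_k - mean_r) / D_k] with [kappa <= D_k], where
    [D_k <= M] with probability close to one.  Write [gap := mu_r - mu_min] and
    [c := kappa / (4 M)], and call [k] weak when [mu_r - mu_k < c * gap].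

    A weak [k] only beats a minimiser of the mean if [mean_r - mean_k] reaches
    [2 c gap], a deviation of at least [c a] with [a := mu_k - mu_min], and then
    [a >= gap / 2]; by the Chernoff bound this has probability at most
    [exp (- n (c a)^2 / (4 sigma^2))].  Either [k] is in the confusion set, and
    [n gap^2 >= C'^2 max(1, log tau)] pays for the [tau] such indices, or
    [a > C sqrt (log d / n)], which pays for the at most [d] others.

    At an index that is not weak, the signal [sqrt n * c * gap] exceeds both the
    noise of the mean (Chernoff) and the studentised threshold (Markov's
    inequality for the empirical variance). *)

(** * Inequalities *)

Lemma lee_expe2r (R : realDomainType) n (x y : \bar R) :
  (0 <= x -> x <= y -> x ^+ n <= y ^+ n)%E.
Proof.
move=> x0 xy; elim: n => [|n IHn]; first by rewrite !expe0.
by rewrite !expeS lee_pmul ?expe_ge0.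
Qed.

Section real_inequalities.
Context (R : realType).

Lemma sqr_le_expRD (y : R) : y ^+ 2 <= 2 * (expR y + expR (- y)).
Proof.
wlog y0 : y / 0 <= y => [hwlog|].
  have [|/ltW y0] := leP 0 y; first exact: hwlog.
  rewrite addrC -[in X in _ + X](opprK y) -sqrrN.
  by apply: hwlog; rewrite oppr_ge0.
have := expR_ge1Dxn 1 y0; have := expR_gt0 (- y).
by rewrite (_ : 2`!%:R = 2 :> R)//; lra.
Qed.

Lemma expRN_le_inv (x : R) : 0 < x -> expR (- x) <= x^-1.
Proof.
move=> x0; rewrite expRN lef_pV2 ?posrE ?expR_gt0//.
by have := expR_ge1Dx x; lra.
Qed.

Lemma sum_expRN_le (I : finType) (A : pred I) (E : I -> R) m (q : R) :
  (#|A| <= m)%N -> (forall i, A i -> q + ln m%:R <= E i) ->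
  \sum_(i | A i) expR (- E i) <= expR (- q).
Proof.
move=> cardA E_ge; have [A0|A_gt0] := posnP #|A|.
  by rewrite big_pred0 ?expR_ge0// => i; move/card0_eq/(_ i): A0.
have m0 : 0 < m%:R :> R by rewrite ltr0n (leq_trans A_gt0).
apply: (@le_trans _ _ (\sum_(i | A i) expR (- q) / m%:R)).
  apply: ler_sum => i Ai; rewrite -(lnK m0) -expRB ler_expR.
  by have := E_ge i Ai; lra.
rewrite sumr_const -[leLHS]mulr_natr mulrAC ler_pdivrMr//.
by rewrite ler_wpM2l ?expR_ge0// ler_nat.
Qed.

Lemma near_ge_sqr (u : nat -> R) (c K : R) :
  0 < c -> u n @[n --> \oo] --> +oo ->
  \forall n \near \oo, K <= (c * u n) ^+ 2.
Proof.
move=> c0 u_oo; near=> n.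
have : (1 + `|K|) / c <= u n by near: n; exact: (cvgryPge _).1.
rewrite ler_pdivrMr// mulrC => cu_ge.
by have := ler_norm K; have := normr_ge0 K; nra.
Unshelve. all: by end_near. Qed.

End real_inequalities.

(** * Measurability and probability bounds *)

Section measurability.
Context (dT : measure_display) (T : measurableType dT) (R : realType).

Lemma measurable_set_ler (f g : T -> R) :
  measurable_fun setT f -> measurable_fun setT g ->
  measurable [set x | f x <= g x].
Proof.
move=> mf mg; rewrite -[X in measurable X]setTI.
exact: (measurable_fun_ler mf mg measurableT (Y := [set true])).
Qed.

Lemma measurable_set_ltr (f g : T -> R) :
  measurable_fun setT f -> measurable_fun setT g ->
  measurable [set x | f x < g x].
Proof.
move=> mf mg; rewrite -[X in measurable X]setTI.
exact: (measurable_fun_ltr mf mg measurableT (Y := [set true])).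
Qed.

Lemma measurable_set_ffun_bool (I : finType) (b : I -> T -> bool)
    (Q : set {ffun I -> bool}) :
  (forall i, measurable_fun setT (b i)) ->
  measurable [set x | Q [ffun i => b i x]].
Proof.
move=> mb; rewrite (_ : mkset _ =
    \bigcup_(c in Q) \bigcap_(i in [set: I]) [set x | b i x = c i]).
  apply: fin_bigcup_measurable => // c _.
  apply: fin_bigcap_measurable => // i _.
  by rewrite -[X in measurable X]setTI; exact: (mb i measurableT [set c i]).
apply/seteqP; split=> [x Qx|x [c Qc cx] /=].
  by exists [ffun i => b i x] => // i _ /=; rewrite ffunE.
by rewrite (_ : finfun _ = c)//; apply/ffunP => i; rewrite ffunE cx.
Qed.

Lemma measurable_fun_sqrt (f : T -> R) :
  measurable_fun setT f -> measurable_fun setT (fun x => Num.sqrt (f x)).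
Proof.
apply: (measurableT_comp (f := @Num.sqrt R)).
by apply: continuous_measurable_fun; exact: sqrt_continuous.
Qed.

Lemma measurable_funV_ge0 (f : T -> R) :
  measurable_fun setT f -> (forall x, 0 <= f x) ->
  measurable_fun setT (fun x => (f x)^-1).
Proof.
move=> mf f0; under eq_fun do rewrite -powR_inv1//.
exact: measurableT_comp (measurable_powR (-1)) mf.
Qed.

End measurability.

Lemma measurable_preimage (d1 d2 : measure_display) (T1 : measurableType d1)
    (T2 : measurableType d2) (f : T1 -> T2) (A : set T2) :
  measurable_fun setT f -> measurable A -> measurable (f @^-1` A).
Proof. by move=> mf mA; rewrite -[X in measurable X]setTI; exact: mf. Qed.

Lemma measurable_fun_tnth (d1 d2 : measure_display) (T1 : measurableType d1)
    (T2 : measurableType d2) (f : T1 -> T2) n (i : 'I_n) :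
  measurable_fun setT f ->
  measurable_fun setT (fun t : n.-tuple T1 => f (tnth t i)).
Proof. by move=> mf; apply: (measurableT_comp mf); exact: measurable_tnth. Qed.

Lemma measurable_exists2 (dT : measure_display) (T : measurableType dT)
    (I : finType) (Q : pred I) (F : I -> set T) :
  (forall i, Q i -> measurable (F i)) ->
  measurable [set x | exists2 i, Q i & F i x].
Proof. by move=> mF; exact: (@fin_bigcup_measurable _ _ _ [set` Q]). Qed.

Section probability_bounds.
Context (dT : measure_display) (T : measurableType dT) (R : realType).
Variable P : probability T R.
Implicit Types A B C : set T.

Lemma le_probability A B :
  measurable A -> measurable B -> A `<=` B -> (P A <= P B)%E.
Proof. by move=> mA mB AB; apply: le_measure => //; exact: mem_set. Qed.

Lemma probability_le_add A B C (b c : R) :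
  measurable A -> measurable B -> measurable C -> A `<=` B `|` C ->
  (P B <= b%:E)%E -> (P C <= c%:E)%E -> (P A <= (b + c)%:E)%E.
Proof.
move=> mA mB mC ABC Bb Cc.
apply: le_trans (le_probability mA (measurableU _ _ mB mC) ABC) _.
by apply: le_trans (measureU2 _ mB mC) _; rewrite EFinD leeD.
Qed.

Lemma union_bound (I : finType) (Q : pred I) (F : I -> set T) :
  (forall i, Q i -> measurable (F i)) ->
  (P [set x | exists2 i, Q i & F i x] <= \sum_(i | Q i) P (F i))%E.
Proof.
move=> mF; rewrite bigfs ?index_enum_uniq// => [|i _]; last first.
  by rewrite mem_index_enum.
by apply: content_sub_fsum => //; exact: measurable_exists2.
Qed.

Lemma markov_ge0 (f : T -> R) (a v : R) :
  measurable_fun setT f -> (forall x, 0 <= f x) -> 0 < a ->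
  (\int[P]_x (f x)%:E <= v%:E)%E -> (P [set x | a <= f x]%R <= (v / a)%:E)%E.
Proof.
move=> mf f0 a0 fv; pose X : {RV P >-> R} := mfun_Sub (mem_set mf).
have := markov X a0 (@measurable_id _ _ setT) (fun r r0 => r0)
  (fun _ _ _ _ => id).
rewrite unlock /= (eq_integral (EFin \o f)) => [|x _]; last first.
  by rewrite /= ger0_norm.
rewrite (_ : [set x | _] = [set x | a <= f x]); last first.
  by apply/seteqP; split=> x /=; rewrite lee_fin ger0_norm.
by move=> Pa; rewrite mulrC EFinM lee_pdivlMl//; exact: le_trans Pa fv.
Qed.

End probability_bounds.

Section iid_theory.
Context (dT : measure_display) (T : measurableType dT) (R : realType).
Variable P : probability T R.
Local Open Scope ereal_scope.

Lemma iidS n (A : set (n.+1.-tuple T)) :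
  iid P n.+1 A = \int[P]_x iid P n [set t | A (tuple_cons (x, t))].
Proof.
by apply: eq_integral => x _; rewrite /= xsectionE.
Qed.

Lemma measurable_iid_section n (A : set (n.+1.-tuple T)) : measurable A ->
  measurable_fun setT (fun x => iid P n [set t | A (tuple_cons (x, t))]).
Proof.
move=> mA; have {}mA := measurable_preimage (@measurable_tuple_cons _ T n) mA.
rewrite (_ : (fun _ => _) = iid P n \o xsection (@tuple_cons _ T n @^-1` A)).
  exact: measurable_fun_xsection.
by apply/funext => x /=; rewrite xsectionE.
Qed.

Lemma ge0_integral_iidS n (f : n.+1.-tuple T -> \bar R) :
  measurable_fun setT f -> (forall t, 0 <= f t) ->
  \int[iid P n.+1]_t f t = \int[P]_x \int[iid P n]_t f (tuple_cons (x, t)).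
Proof.
move=> mf f0; rewrite /= ge0_integral_distribution// fubini_tonelli1//=.
by apply: measurableT_comp => //; exact: measurable_tuple_cons.
Qed.

Lemma iid_tnth n (i : 'I_n) (A : set T) : measurable A ->
  iid P n [set t | A (tnth t i)] = P A.
Proof.
move=> mA; pose B (j : 'I_n) := if j == i then A else setT.
have mB j : measurable (B j) by rewrite /B; case: ifP.
rewrite (_ : mkset _ = [set t | forall j, B j (tnth t j)]).
  rewrite iid_box// (bigD1 i)//= {1}/B eqxx big1 ?mule1// => j /negbTE ji.
  by rewrite /B ji probability_setT.
apply/seteqP; split => [t At j|t /(_ i)]; last by rewrite /B eqxx.
by rewrite /B; case: eqP => // ->.
Qed.

Lemma ge0_integral_iid_tnth n (i : 'I_n) (f : T -> \bar R) :
  measurable_fun setT f -> (forall x, 0 <= f x) ->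
  \int[iid P n]_t f (tnth t i) = \int[P]_x f x.
Proof.
move=> mf f0; have mi : measurable_fun setT (fun t : n.-tuple T => tnth t i).
  exact: measurable_tnth.
pose X : {RV iid P n >-> T} := mfun_Sub (mem_set mi).
transitivity (\int[distribution (iid P n) X]_x f x).
  by rewrite ge0_integral_distribution.
by apply: eq_measure_integral => A mA _; exact: iid_tnth.
Qed.

Lemma ge0_integral_iid_sum n (f : T -> R) :
  measurable_fun setT f -> (forall x, 0 <= f x)%R ->
  \int[iid P n]_t (\sum_(i < n) f (tnth t i))%:E = (\int[P]_x (f x)%:E) *+ n.
Proof.
move=> mf f0; under eq_integral do rewrite -sumEFin.
have mfE : measurable_fun setT (fun x => (f x)%:E) by exact/measurable_EFinP.
rewrite ge0_integral_sum//=; first last.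
- by move=> i t _; rewrite lee_fin.
- by move=> i; exact: measurable_fun_tnth mfE.
rewrite (eq_bigr (fun=> \int[P]_x (f x)%:E)); last first.
  by move=> i _; rewrite (@ge0_integral_iid_tnth _ i (fun x => (f x)%:E)).
by rewrite sumr_const card_ord.
Qed.

Lemma ge0_integral_iid_prod n (f : T -> R) :
  measurable_fun setT f -> (forall x, 0 <= f x)%R ->
  \int[iid P n]_t (\prod_(i < n) f (tnth t i))%:E = (\int[P]_x (f x)%:E) ^+ n.
Proof.
move=> mf f0.
have mprod k : measurable_fun setT
    (fun t : k.-tuple T => (\prod_(i < k) f (tnth t i))%:E).
  by apply/measurable_EFinP/measurable_prod => i _; exact: measurable_fun_tnth.
have prod_ge0 k (t : k.-tuple T) : 0 <= (\prod_(i < k) f (tnth t i))%:E.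
  by rewrite lee_fin prodr_ge0.
elim: n => [|n IHn].
  under eq_integral do rewrite big_ord0.
  by rewrite integral_cst//= probability_setT mule1.
rewrite ge0_integral_iidS//.
transitivity (\int[P]_x ((f x)%:E * (\int[P]_x (f x)%:E) ^+ n)).
  apply: eq_integral => x _; rewrite -IHn.
  rewrite -ge0_integralZl ?lee_fin//; last exact: mprod.
  apply: eq_integral => t _; rewrite big_ord_recl EFinM.
  by congr (_ * _%:E); apply: eq_bigr => i _; rewrite tnthS.
rewrite ge0_integralZr//.
- by rewrite expeS.
- exact/measurable_EFinP.
- by move=> t _; rewrite lee_fin.
- by apply/expe_ge0/integral_ge0 => x _; rewrite lee_fin.
Qed.

End iid_theory.

(** * Splitting an independent sample *)

Section sample_splitting.
Context (dT : measure_display) (T : measurableType dT) (n m : nat).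

Definition tuple_left (w : (n + m).-tuple T) : n.-tuple T :=
  [tuple tnth w (lshift m i) | i < n].

Definition tuple_right (w : (n + m).-tuple T) : m.-tuple T :=
  [tuple tnth w (rshift n i) | i < m].

Lemma measurable_tuple_left : measurable_fun setT tuple_left.
Proof.
apply/measurable_fun_tnthP => i.
rewrite (_ : _ \o _ = @tnth _ T ^~ (lshift m i)); first exact: measurable_tnth.
by apply/funext => w; exact: tnth_mktuple.
Qed.

Lemma measurable_tuple_right : measurable_fun setT tuple_right.
Proof.
apply/measurable_fun_tnthP => i.
rewrite (_ : _ \o _ = @tnth _ T ^~ (rshift n i)); first exact: measurable_tnth.
by apply/funext => w; exact: tnth_mktuple.
Qed.

End sample_splitting.

Section split_independence.
Context (dT : measure_display) (T : measurableType dT) (R : realType).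
Variable P : probability T R.
Local Open Scope ereal_scope.

Lemma tuple_left_cons n m (x : T) (t : (n + m).-tuple T) :
  tuple_left (tuple_cons (x, t) : (n.+1 + m).-tuple T) =
  tuple_cons (x, tuple_left t).
Proof.
apply: eq_from_tnth => i; rewrite tnth_mktuple.
have [j ->|->] := unliftP ord0 i; last by rewrite !(tnth_nth x).
by rewrite tnthS tnth_mktuple !(tnth_nth x).
Qed.

Lemma tuple_right_cons n m (x : T) (t : (n + m).-tuple T) :
  tuple_right (tuple_cons (x, t) : (n.+1 + m).-tuple T) = tuple_right t.
Proof. by apply: eq_from_tnth => i; rewrite !tnth_mktuple !(tnth_nth x). Qed.

Lemma iid_left_right n m (A : set (n.-tuple T)) (B : set (m.-tuple T)) :
  measurable A -> measurable B ->
  iid P (n + m) [set w | A (tuple_left w) /\ B (tuple_right w)] =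
  iid P n A * iid P m B.
Proof.
move=> + mB; elim: n A => [|n IHn] A mA.
  have leftE (w : (0 + m).-tuple T) : tuple_left w = nil_tuple T.
    exact: tuple0.
  have rightE (w : (0 + m).-tuple T) : tuple_right w = w.
    apply: eq_from_tnth => i; rewrite tnth_mktuple.
    by congr tnth; exact: val_inj.
  under eq_set do rewrite leftE rightE.
  rewrite [iid P 0 A]diracE; have [/set_mem A0|/negP A0] := boolP (_ \in A).
    by rewrite mul1e; congr (iid P m _); apply/seteqP; split=> [w []|w].
  rewrite mul0e (_ : mkset _ = set0) ?measure0//.
  by apply/seteqP; split=> // w [/mem_set].
rewrite [iid P n.+1 A]iidS [LHS](iidS P (n := n + m)).
rewrite -ge0_integralZr//; last exact: measurable_iid_section.
apply: eq_integral => x _; rewrite -IHn.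
  congr (iid P _ _).
  by apply/seteqP; split=> t /=; rewrite tuple_left_cons tuple_right_cons.
apply: (measurable_preimage _ mA).
exact: (measurable_cons (f := cst x) (g := id)).
Qed.

Lemma iid_tuple_right n m (B : set (m.-tuple T)) : measurable B ->
  iid P (n + m) [set w | B (tuple_right w)] = iid P m B.
Proof.
move=> mB; have := iid_left_right (@measurableT _ (n.-tuple T)) mB.
rewrite probability_setT mul1e => <-.
by congr (iid P _ _); apply/seteqP; split=> w //= [].
Qed.

Section selected_event.
Context (n m : nat) (I : finType).
Variables (s : m.-tuple T -> I) (A : I -> set (n.-tuple T)).
Hypotheses (ms : forall k, measurable [set t | s t = k]).
Hypotheses (mA : forall k, measurable (A k)).

Lemma measurable_selection_pred (Q : pred I) : measurable [set t | Q (s t)].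
Proof.
rewrite (_ : mkset _ = [set t | exists2 k, Q k & s t = k]).
  by apply: measurable_exists2 => k _; exact: ms.
by apply/seteqP; split => [t Qt|t [k Qk tk]]; [exists (s t)|rewrite /= tk].
Qed.

Let selected k :=
  [set w : (n + m).-tuple T | A k (tuple_left w) /\ s (tuple_right w) = k].

Let measurable_selected k : measurable (selected k).
Proof.
apply: measurableI.
  exact: measurable_preimage (@measurable_tuple_left _ T n m) (mA k).
exact: measurable_preimage (@measurable_tuple_right _ T n m) (ms k).
Qed.

Lemma measurable_selected_event :
  measurable [set w : (n + m).-tuple T | A (s (tuple_right w)) (tuple_left w)].
Proof.
rewrite (_ : mkset _ = [set w | exists2 k, xpredT k & selected k w]).
  by apply: measurable_exists2 => k _.
apply/seteqP; split=> [w Aw|w [k _ [Ak /= ->]]//].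
by exists (s (tuple_right w)).
Qed.

(* Given the right half, the selected index is a constant for the left half. *)
Lemma selected_event_le (bad : pred I) (a b : R) :
  iid P m [set t | bad (s t)] <= a%:E ->
  (forall k, ~~ bad k -> iid P n (A k) <= b%:E) -> (0 <= b)%R ->
  iid P (n + m) [set w | A (s (tuple_right w)) (tuple_left w)] <= (a + b)%:E.
Proof.
move=> bad_le good_le b0; pose good k := ~~ bad k.
have mbad := measurable_selection_pred bad.
apply: (@probability_le_add _ _ _ _ _
  [set w | bad (s (tuple_right w))]
  [set w | exists2 k, good k & selected k w]).
- exact: measurable_selected_event.
- exact: measurable_preimage (@measurable_tuple_right _ T n m) mbad.
- by apply: measurable_exists2 => k _.
- move=> w /= Aw; have [|good_s] := boolP (bad (s (tuple_right w))); [by left|].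
  by right; exists (s (tuple_right w)).
- by rewrite (iid_tuple_right n mbad).
apply: (le_trans (union_bound _ _)) => //.
apply: (@le_trans _ _ (\sum_(k | good k) iid P m [set t | s t = k] * b%:E)).
  apply: lee_sum => k good_k.
  by rewrite (iid_left_right (mA k) (ms k)) muleC lee_wpmul2l// good_le.
rewrite -ge0_sume_distrl; last by move=> k _.
rewrite -[leRHS]mul1e lee_wpmul2r ?lee_fin//.
rewrite bigfs ?index_enum_uniq// => [|k _]; last by rewrite mem_index_enum.
rewrite -measure_fin_bigcup//; last exact/trivIset_preimage1.
by apply: probability_le1; exact: fin_bigcup_measurable.
Qed.

End selected_event.
End split_independence.

(** * Empirical means and variances *)

Section empirical_statistics.
Context (dT : measure_display) (T : measurableType dT) (R : realType).
Implicit Types f : T -> R.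

Definition empirical_mean f n (t : n.-tuple T) : R :=
  n%:R^-1 * \sum_(i < n) f (tnth t i).

Definition empirical_var f n (t : n.-tuple T) : R :=
  (n.-1)%:R^-1 * \sum_(i < n) (f (tnth t i) - empirical_mean f t) ^+ 2.

Lemma measurable_empirical_mean f n : measurable_fun setT f ->
  measurable_fun setT (@empirical_mean f n).
Proof.
move=> mf; apply: measurable_funM => //; apply: measurable_sum => i.
exact: measurable_fun_tnth.
Qed.

Lemma measurable_empirical_var f n : measurable_fun setT f ->
  measurable_fun setT (@empirical_var f n).
Proof.
move=> mf; apply: measurable_funM => //; apply: measurable_sum => i.
apply: measurable_funX; apply: measurable_funB.
  exact: measurable_fun_tnth.
exact: measurable_empirical_mean.
Qed.

Lemma empirical_var_ge0 f n (t : n.-tuple T) : 0 <= empirical_var f t.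
Proof. by apply: mulr_ge0 => //; apply: sumr_ge0 => i _; exact: sqr_ge0. Qed.

Lemma sum_empirical_mean f n (t : n.-tuple T) :
  \sum_(i < n) f (tnth t i) = n%:R * empirical_mean f t.
Proof.
rewrite /empirical_mean mulrA; case: n t => [t|n t].
  by rewrite big_ord0 mulr0.
by rewrite mulfV ?pnatr_eq0// mul1r.
Qed.

Lemma empirical_meanN f n (t : n.-tuple T) :
  empirical_mean (\- f) t = - empirical_mean f t.
Proof. by rewrite /empirical_mean sumrN mulrN. Qed.

Lemma sum_sqr_deviation f n (t : n.-tuple T) (c : R) :
  \sum_(i < n) (f (tnth t i) - c) ^+ 2 =
  \sum_(i < n) (f (tnth t i) - empirical_mean f t) ^+ 2
    + n%:R * (empirical_mean f t - c) ^+ 2.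
Proof.
set a := empirical_mean f t; apply/eqP; rewrite -subr_eq0 opprD addrA -sumrB.
rewrite (eq_bigr (fun i => (a - c) * (2 * f (tnth t i) - (a + c)))); last first.
  by move=> i _; ring.
rewrite -mulr_sumr sumrB -mulr_sumr sum_empirical_mean -/a sumr_const card_ord.
by rewrite -mulr_natl; apply/eqP; ring.
Qed.

End empirical_statistics.

Section empirical_var_expectation.
Context (dT : measure_display) (T : measurableType dT) (R : realType).
Variable P : probability T R.

Lemma expectation_empirical_var_le (f : T -> R) (c v : R) n :
  (1 < n)%N -> measurable_fun setT f ->
  (\int[P]_x ((f x - c) ^+ 2)%:E <= v%:E)%E ->
  (\int[iid P n]_t (empirical_var f t)%:E <= (2 * v)%:E)%E.
Proof.
move=> n1 mf fv; pose g x := (f x - c) ^+ 2.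
have g_ge0 x : 0 <= g x by exact: sqr_ge0.
have mg : measurable_fun setT g.
  by apply: measurable_funX; exact: measurable_funB.
have msum : measurable_fun setT
    (fun t : n.-tuple T => \sum_(i < n) g (tnth t i)).
  by apply: measurable_sum => i; exact: measurable_fun_tnth.
have sum_ge0 (t : n.-tuple T) : 0 <= \sum_(i < n) g (tnth t i).
  exact: sumr_ge0.
have pred_ge1 : 1 <= (n.-1)%:R :> R by rewrite ler1n -ltnS prednK// ltnW.
have nE : n%:R = (n.-1)%:R + 1 :> R by rewrite natr1 prednK// ltnW.
have v_ge0 : 0 <= v.
  rewrite -lee_fin; apply: le_trans fv.
  by apply: integral_ge0 => x _; rewrite lee_fin sqr_ge0.
apply: (@le_trans _ _ (\int[iid P n]_t
    ((n.-1)%:R^-1%:E * (\sum_(i < n) g (tnth t i))%:E))%E).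
  apply: ge0_le_integral => //.
  - by move=> t _; rewrite lee_fin empirical_var_ge0.
  - by apply/measurable_EFinP; exact: measurable_empirical_var.
  - by apply: emeasurable_funM => //; exact/measurable_EFinP.
  - move=> t _; rewrite -EFinM lee_fin ler_wpM2l// (sum_sqr_deviation _ _ c).
    by rewrite lerDl mulr_ge0 ?sqr_ge0.
rewrite ge0_integralZl//; first last.
- by move=> t _; rewrite lee_fin.
- exact/measurable_EFinP.
rewrite ge0_integral_iid_sum// -mule_natl.
apply: (@le_trans _ _ ((n.-1)%:R^-1%:E * (n%:R%:E * v%:E))%E).
  by rewrite !lee_wpmul2l ?lee_fin ?invr_ge0.
rewrite -!EFinM lee_fin ler_pdivrMl ?(lt_le_trans ltr01)// nE; nra.
Qed.

End empirical_var_expectation.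

Section scalar_subgaussian.
Context (dT : measure_display) (T : measurableType dT) (R : realType).
Variable P : probability T R.
Implicit Types (f : T -> R) (v m : R).

Definition scalar_subgaussian v m f : Prop :=
  measurable_fun setT f /\
  forall l, (\int[P]_x (expR (l * (f x - m)))%:E <=
    (expR (l ^+ 2 * v / 2))%:E)%E.

Lemma scalar_subgaussian_variance v m f : 0 < v -> scalar_subgaussian v m f ->
  (\int[P]_x ((f x - m) ^+ 2)%:E <= (4 * expR (1 / 2) * v)%:E)%E.
Proof.
move=> v0 [mf mgf]; pose s := Num.sqrt v.
have sE : s ^+ 2 = v by rewrite sqr_sqrtr// ltW.
have s0 : s != 0 by rewrite gt_eqF// sqrtr_gt0.
pose expY (l : R) x := (expR (l * (f x - m)))%:E.
have mexpY l : measurable_fun setT (expY l).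
  apply/measurable_EFinP; apply: (measurableT_comp (f := expR)) => //.
  by apply: measurable_funM => //; exact: measurable_funB.
have expY_ge0 l x : (0 <= expY l x)%E by rewrite lee_fin expR_ge0.
have expY_le l : l ^+ 2 = v^-1 -> (\int[P]_x expY l x <= (expR (1 / 2))%:E)%E.
  by move=> lE; apply: le_trans (mgf l) _; rewrite lE mulVf// gt_eqF.
apply: (@le_trans _ _ (\int[P]_x
    ((2 * v)%:E * (expY s^-1%R x + expY (- s^-1)%R x)))%E).
  apply: ge0_le_integral => //.
  - by move=> x _; rewrite lee_fin sqr_ge0.
  - by apply/measurable_EFinP/measurable_funX; exact: measurable_funB.
  - by apply: emeasurable_funM => //; exact: emeasurable_funD.
  - move=> x _; rewrite -EFinD -EFinM lee_fin -sE mulNr -mulrA mulrCA.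
    rewrite -ler_pdivrMl ?exprn_gt0 ?sqrtr_gt0// -exprVn -exprMn.
    exact: sqr_le_expRD.
rewrite ge0_integralZl//; last 3 first.
- exact: emeasurable_funD.
- by move=> x _; rewrite adde_ge0.
- by rewrite lee_fin mulr_ge0// ltW.
rewrite ge0_integralD//.
rewrite (_ : 4 * _ * v = 2 * v * (expR (1 / 2) + expR (1 / 2))); last by ring.
rewrite [leRHS]EFinM lee_wpmul2l ?lee_fin ?mulr_ge0 ?(ltW v0)//.
by rewrite EFinD leeD// expY_le// ?sqrrN exprVn sE.
Qed.

Lemma chernoff_empirical_mean v m f n (a : R) :
  0 < v -> scalar_subgaussian v m f -> (0 < n)%N -> 0 < a ->
  (iid P n [set t | a <= empirical_mean f t - m]%R <=
   (expR (- (n%:R * a ^+ 2 / (2 * v))))%:E)%E.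
Proof.
move=> v0 [mf mgf] n0 a0; pose l := a / v; have l0 : 0 < l by rewrite divr_gt0.
pose g x := expR (l * (f x - m)).
have mg : measurable_fun setT g.
  apply: (measurableT_comp (f := expR)) => //; apply: measurable_funM => //.
  exact: measurable_funB.
have prodE (t : n.-tuple T) :
    \prod_(i < n) g (tnth t i) = expR (l * (n%:R * (empirical_mean f t - m))).
  rewrite -expR_sum -mulr_sumr sumrB sumr_const card_ord sum_empirical_mean.
  by rewrite -[m *+ n]mulr_natl -mulrBr.
have -> : [set t : n.-tuple T | a <= empirical_mean f t - m] =
    [set t | expR (l * (n%:R * a)) <= \prod_(i < n) g (tnth t i)].
  by apply/seteqP; split => t /=; rewrite prodE ler_expR !ler_pM2l// ltr0n.
rewrite (_ : expR (- _) =
    expR (n%:R * (l ^+ 2 * v / 2)) / expR (l * (n%:R * a))); last first.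
  by rewrite -expRB; congr expR; rewrite /l; field; rewrite gt_eqF.
apply: markov_ge0 (expR_gt0 _) _ => [|t|].
- by apply: measurable_prod => i _; exact: measurable_fun_tnth.
- by apply: prodr_ge0 => i _; exact: expR_ge0.
rewrite ge0_integral_iid_prod// => [|x]; last exact: expR_ge0.
rewrite expRM_natl EFin_expe lee_expe2r//; last exact: mgf.
by apply: integral_ge0 => x _; rewrite lee_fin expR_ge0.
Qed.

Lemma scalar_subgaussianN v m f :
  scalar_subgaussian v m f -> scalar_subgaussian v (- m) (\- f).
Proof.
move=> [mf mgf]; split=> [|l]; first exact: measurable_funN.
rewrite -sqrrN (eq_integral (fun x => (expR (- l * (f x - m)))%:E)) => [|x _].
  exact: mgf.
by congr (expR _)%:E; rewrite /=; ring.
Qed.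

Lemma chernoff_empirical_mean_lower v m f n (a : R) :
  0 < v -> scalar_subgaussian v m f -> (0 < n)%N -> 0 < a ->
  (iid P n [set t | empirical_mean f t <= m - a]%R <=
   (expR (- (n%:R * a ^+ 2 / (2 * v))))%:E)%E.
Proof.
move=> v0 /scalar_subgaussianN Pf n0 a0.
rewrite (_ : mkset _ = [set t | a <= empirical_mean (\- f) t - - m]).
  exact: chernoff_empirical_mean.
by apply/seteqP; split=> t /=; rewrite empirical_meanN; lra.
Qed.

Lemma empirical_var_tail v m f n (b a : R) :
  0 < v -> scalar_subgaussian v m f -> (1 < n)%N -> 0 <= b -> 0 < a ->
  (iid P n [set t | a <= b * empirical_var f t]%R <=
   (b * (8 * expR (1 / 2) * v) / a)%:E)%E.
Proof.
move=> v0 Pf n1 b0 a0; have [mf _] := Pf.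
have mvar := measurable_empirical_var (n := n) mf.
apply: markov_ge0 => // [|t|]; first exact: measurable_funM.
  by rewrite mulr_ge0 ?empirical_var_ge0.
under eq_integral do rewrite EFinM.
rewrite ge0_integralZl//; last 2 first.
- exact/measurable_EFinP.
- by move=> t _; rewrite lee_fin empirical_var_ge0.
rewrite [leRHS]EFinM lee_wpmul2l ?lee_fin//.
rewrite (_ : 8 * _ * v = 2 * (4 * expR (1 / 2) * v)); last by ring.
apply: (expectation_empirical_var_le n1 mf).
exact: scalar_subgaussian_variance v0 Pf.
Qed.

End scalar_subgaussian.

Section studentized_test.
Context (dT : measure_display) (T : measurableType dT) (R : realType).
Variable P : probability T R.
Implicit Types (f : T -> R) (z v m : R).

Definition studentized_acceptance z f n : set (n.-tuple T) :=
  [set t | Num.sqrt n%:R * empirical_mean f t <=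
           z * Num.sqrt (empirical_var f t)].

Definition type2_const z : R := 8 + 32 * expR (1 / 2) * z ^+ 2.

Lemma type2_const_gt0 z : 0 < type2_const z.
Proof. by rewrite ltr_pwDl// mulr_ge0 ?sqr_ge0// mulr_ge0 ?expR_ge0. Qed.

Lemma measurable_studentized_acceptance z f n : measurable_fun setT f ->
  measurable (studentized_acceptance z f (n := n)).
Proof.
move=> mf; apply: measurable_set_ler; apply: measurable_funM => //.
  exact: measurable_empirical_mean.
by apply: measurable_fun_sqrt; exact: measurable_empirical_var.
Qed.

(* Acceptance forces either the mean to fall below m / 2 or the variance to
   exceed n (m / 2)^2 / z^2. *)
Lemma studentized_acceptance_le z v m f n :
  0 < v -> 0 < m -> (1 < n)%N -> scalar_subgaussian P v m f ->
  (iid P n (studentized_acceptance z f (n := n)) <=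
   (type2_const z * v / (n%:R * m ^+ 2))%:E)%E.
Proof.
move=> v0 m0 n1 Pf; have [mf _] := Pf; have n0 : (0 < n)%N by exact: ltnW.
have nR0 : 0 < n%:R :> R by rewrite ltr0n.
pose small_mean := [set t : n.-tuple T | empirical_mean f t <= m - m / 2].
pose large_var := [set t : n.-tuple T |
  n%:R * (m / 2) ^+ 2 <= z ^+ 2 * empirical_var f t].
have threshold_gt0 : 0 < n%:R * (m / 2) ^+ 2.
  by rewrite mulr_gt0 ?exprn_gt0 ?divr_gt0.
rewrite (_ : type2_const z * v / _ = 8 * v / (n%:R * m ^+ 2) +
    z ^+ 2 * (8 * expR (1 / 2) * v) / (n%:R * (m / 2) ^+ 2)); last first.
  by rewrite /type2_const; field; rewrite !gt_eqF.
apply: (@probability_le_add _ _ _ _ _ small_mean large_var).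
- exact: measurable_studentized_acceptance.
- by apply: measurable_set_ler => //; exact: measurable_empirical_mean.
- apply: measurable_set_ler => //; apply: measurable_funM => //.
  exact: measurable_empirical_var.
- move=> t accept; rewrite /small_mean /large_var /=.
  have [|mean_gt] := leP (empirical_mean f t) (m - m / 2); [by left|right].
  have signal_le : Num.sqrt n%:R * (m / 2) <= z * Num.sqrt (empirical_var f t).
    by apply: le_trans accept; rewrite ler_wpM2l ?sqrtr_ge0//; lra.
  have signal_ge0 : 0 <= Num.sqrt n%:R * (m / 2).
    by rewrite mulr_ge0 ?sqrtr_ge0 ?divr_ge0 ?(ltW m0).
  have := ler_pM signal_ge0 signal_ge0 signal_le signal_le.
  by rewrite -!expr2 !exprMn !sqr_sqrtr ?empirical_var_ge0// ltW.
- have half_m0 : 0 < m / 2 by rewrite divr_gt0.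
  apply: le_trans (chernoff_empirical_mean_lower v0 Pf n0 half_m0) _.
  rewrite (_ : 8 * v / _ = (n%:R * (m / 2) ^+ 2 / (2 * v))^-1).
    by rewrite lee_fin expRN_le_inv ?divr_gt0 ?mulr_gt0.
  by field; rewrite !gt_eqF.
- by apply: empirical_var_tail Pf _ _ _; rewrite ?sqr_ge0.
Qed.

End studentized_test.

(** * Selection rules *)

Section pairwise_differences.
Context (R : realType) (d : nat).
Implicit Types (j k : 'I_d) (x : d.-tuple R).

Definition coord_diff j k x : R := tnth x j - tnth x k.

Lemma measurable_coord_diff j k : measurable_fun setT (coord_diff j k).
Proof. by apply: measurable_funB; exact: measurable_tnth. Qed.

Lemma dotv_gammav j k (u : 'cV[R]_d) : dotv (gammav R j k) u = u j 0 - u k 0.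
Proof. by rewrite /dotv /gammav linearB /= !trmx_delta mulmxBl -!rowE !mxE. Qed.

Lemma dotv_gammav_gammav j k : j != k -> dotv (gammav R j k) (gammav R j k) = 2.
Proof.
move=> jk; rewrite dotv_gammav !mxE !eqxx (negbTE jk) eq_sym (negbTE jk) /=.
by rewrite subr0 sub0r opprK.
Qed.

Lemma dotvZl (a : R) (u v : 'cV[R]_d) : dotv (a *: u) v = a * dotv u v.
Proof. by rewrite /dotv linearZ /= -scalemxAl mxE. Qed.

Lemma dotvZr (a : R) (u v : 'cV[R]_d) : dotv u (a *: v) = a * dotv u v.
Proof. by rewrite /dotv -scalemxAr mxE. Qed.

Lemma sample_mean_diff n (t : n.-tuple (d.-tuple R)) j k :
  sample_mean (fun i => colv (tnth t i)) j 0 -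
  sample_mean (fun i => colv (tnth t i)) k 0 =
  empirical_mean (coord_diff j k) t.
Proof.
rewrite /sample_mean !mxE !summxE -mulrBr -sumrB; congr (_ * _).
by apply: eq_bigr => i _; rewrite !mxE.
Qed.

Lemma qform_sample_cov n (t : n.-tuple (d.-tuple R)) j k :
  qform (sample_cov (fun i => colv (tnth t i))) (gammav R j k) =
  empirical_var (coord_diff j k) t.
Proof.
rewrite /qform /sample_cov /empirical_var -scalemxAr -scalemxAl mxE.
congr (_ * _); rewrite mulmx_sumr mulmx_suml summxE; apply: eq_bigr => i _.
set u := _ - _.
have -> : coord_diff j k (tnth t i) - empirical_mean (coord_diff j k) t =
    dotv (gammav R j k) u.
  by rewrite dotv_gammav -sample_mean_diff /u /coord_diff !mxE; ring.
rewrite mulmxA -(mulmxA ((gammav R j k)^T *m u)) mxE big_ord1 expr2.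
by congr (_ * _); rewrite /dotv -[u^T *m _]trmxK trmx_mul trmxK mxE.
Qed.

(* The unit vector is gamma / sqrt 2, which doubles the variance proxy. *)
Lemma subgaussian_coord_diff sigma (P : probability (d.-tuple R) R) j k :
  subgaussian sigma P -> j != k ->
  scalar_subgaussian P (2 * sigma ^+ 2) (meanv P j 0 - meanv P k 0)
    (coord_diff j k).
Proof.
move=> [_ mgf] jk; split=> [|l]; first exact: measurable_coord_diff.
have sqrt2_neq0 : Num.sqrt 2 != 0 :> R by rewrite sqrtr_eq0 -ltNge.
have sqrt2K : Num.sqrt 2 ^+ 2 = 2 :> R by rewrite sqr_sqrtr.
have := mgf (l * Num.sqrt 2) ((Num.sqrt 2)^-1 *: gammav R j k).
rewrite dotvZl dotvZr dotv_gammav_gammav// mulrA -expr2 exprVn sqrt2K mulVf//.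
rewrite unlock exprMn sqrt2K (mulrA (l ^+ 2)) => /(_ erefl).
congr (_ <= _)%E; apply: eq_integral => x _; congr (expR _)%:E.
by rewrite dotvZl dotv_gammav !mxE /coord_diff; field.
Qed.

End pairwise_differences.

Section argmin_theory.
Context (R : realType) (d : nat).
Implicit Types (r k : 'I_d) (F G D : 'I_d -> R).

Lemma sargmin_exceptP r F k0 : k0 != r ->
  sargmin_except r F != r /\ forall k, k != r -> F (sargmin_except r F) <= F k.
Proof.
move=> k0r; rewrite /sargmin_except.
have [kmin kmin_r kmin_le] := arg_minP (P := fun k => k != r) F k0r.
have kmin_argmin : kmin \in argmin_except r F.
  by rewrite inE kmin_r; apply/forallP => j; apply/implyP; exact: kmin_le.
case: pickP => [k /andP[]|].
  rewrite inE => /andP[kr /forallP kP] _ /=.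
  by split=> // j; exact/implyP/kP.
have [kfst kfst_argmin kfst_le] := arg_minnP (fun k : 'I_d => k : nat) kmin_argmin.
move=> /(_ kfst)/negP[]; apply/andP; split; first exact: kfst_argmin.
by apply/forallP => j; apply/implyP; exact: kfst_le.
Qed.

Lemma eq_sargmin_except r F G :
  (forall j k, (F j <= F k) = (G j <= G k)) ->
  sargmin_except r F = sargmin_except r G.
Proof.
move=> FG; rewrite /sargmin_except.
rewrite (_ : argmin_except r F = argmin_except r G)//.
apply/setP => k; rewrite !inE; congr (_ && _).
by apply: eq_forallb => j; rewrite FG.
Qed.

Lemma sargmin_ratio_le r F D (kappa M : R) k0 :
  (forall k, 0 < D k) -> (forall k, kappa <= D k) ->
  k0 != r -> F k0 <= 0 -> D k0 <= M ->
  M * F (sargmin_except r (fun k => F k / D k)) <= kappa * F k0.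
Proof.
move=> D0 D_ge k0r Fk0 Dk0.
have [_ /(_ _ k0r)] := sargmin_exceptP (fun k => F k / D k) k0r.
set s := sargmin_except _ _.
rewrite ler_pdivrMr// mulrAC ler_pdivlMr// => cross.
have : F k0 * D s <= F k0 * kappa by rewrite ler_wnM2l.
have Fs : F s <= 0.
  rewrite -(pmulr_lle0 _ (D0 k0)); apply: le_trans cross _.
  by rewrite pmulr_lle0.
have : F s * M <= F s * D k0 by rewrite ler_wnM2l.
by lra.
Qed.

Lemma measurable_sargmin_except (dT : measure_display) (T : measurableType dT)
    (r k : 'I_d) (F : 'I_d -> T -> R) :
  (forall j, measurable_fun setT (F j)) ->
  measurable [set x | sargmin_except r (F^~ x) = k].
Proof.
move=> mF; pose compare (p : 'I_d * 'I_d) x := F p.1 x <= F p.2 x.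
pose selects_k (c : {ffun 'I_d * 'I_d -> bool}) : Prop :=
  exists2 x, c = [ffun p => compare p x] & sargmin_except r (F^~ x) = k.
rewrite (_ : mkset _ = [set x | selects_k [ffun p => compare p x]]).
  by apply: measurable_set_ffun_bool => p; exact: measurable_fun_ler.
apply/seteqP; split=> [x xk|x [y /ffunP yx yk]]; first by exists x.
rewrite /= -yk; apply: eq_sargmin_except => i j.
by have := yx (i, j); rewrite !ffunE.
Qed.

End argmin_theory.

Section score_selection.
Context (R : realType) (d n : nat) (r : 'I_d).
Implicit Types (k : 'I_d) (t : n.-tuple (d.-tuple R)).
Implicit Types w : (n + n).-tuple (d.-tuple R).
Implicit Types D : 'I_d -> n.-tuple (d.-tuple R) -> R.

Definition score_select D t : 'I_d :=
  sargmin_except r (fun k => - empirical_mean (coord_diff r k) t / D k t).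

Definition adj_scale (kappa : R) k t : R :=
  Num.max (Num.sqrt (empirical_var (coord_diff r k) t)) kappa.

Lemma half1_tuple_left w : half1 w = fun i => colv (tnth (tuple_left w) i).
Proof. by apply/funext => i; rewrite tnth_mktuple. Qed.

Lemma half2_tuple_right w : half2 w = fun i => colv (tnth (tuple_right w) i).
Proof. by apply/funext => i; rewrite tnth_mktuple. Qed.

Lemma s_plugE :
  s_plug n r = score_select (fun _ _ => 1) \o @tuple_right _ _ n n.
Proof.
apply/funext => w; apply: eq_sargmin_except => j k.
by rewrite !divr1 lerN2 -!sample_mean_diff -half2_tuple_right lerD2l lerN2.
Qed.

Lemma s_adjE kappa :
  s_adj n kappa r = score_select (adj_scale kappa) \o @tuple_right _ _ n n.
Proof.
apply/funext => w; rewrite /s_adj half2_tuple_right; congr sargmin_except.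
by apply/funext => k; rewrite -opprB sample_mean_diff qform_sample_cov.
Qed.

Lemma rejection_setC alpha (s : n.-tuple (d.-tuple R) -> 'I_d) :
  ~` rejection n alpha r (s \o @tuple_right _ _ n n) =
  [set w | studentized_acceptance (normal_quantile (1 - alpha))
             (coord_diff r (s (tuple_right w))) (tuple_left w)].
Proof.
apply/seteqP; split=> w;
  rewrite /rejection /studentized_acceptance /= half1_tuple_left dotv_gammav;
  rewrite sample_mean_diff qform_sample_cov leNgt => /negP//.
Qed.

Lemma measurable_score_select D k :
  (forall j, measurable_fun setT (D j)) -> (forall j t, 0 < D j t) ->
  measurable [set t | score_select D t = k].
Proof.
move=> mD D0; apply: measurable_sargmin_except => j; apply: measurable_funM.
  apply: measurable_funN; apply: measurable_empirical_mean.
  exact: measurable_coord_diff.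
apply: measurable_funV_ge0 => // t; exact: ltW.
Qed.

Lemma measurable_adj_scale kappa k : measurable_fun setT (adj_scale kappa k).
Proof.
apply: measurable_maxr => //; apply: measurable_fun_sqrt.
by apply: measurable_empirical_var; exact: measurable_coord_diff.
Qed.

Lemma le_adj_scale kappa k t : kappa <= adj_scale kappa k t.
Proof. by rewrite le_max lexx orbT. Qed.

Lemma adj_scale_tail sigma (P : probability (d.-tuple R) R) kappa k (M : R) :
  0 < sigma -> subgaussian sigma P -> (1 < n)%N -> r != k ->
  kappa <= M -> 0 < M ->
  (iid P n [set t | M < adj_scale kappa k t]%R <=
   (16 * expR (1 / 2) * sigma ^+ 2 / M ^+ 2)%:E)%E.
Proof.
move=> sigma0 subP n1 rk kM M0.
have v0 : 0 < 2 * sigma ^+ 2 by rewrite mulr_gt0 ?exprn_gt0.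
have Pf := subgaussian_coord_diff subP rk.
have := empirical_var_tail v0 Pf n1 ler01 (exprn_gt0 2 M0).
rewrite (_ : 1 * (8 * _ * _) = 16 * expR (1 / 2) * sigma ^+ 2); last by ring.
apply: le_trans; apply: le_probability.
- by apply: measurable_set_ltr => //; exact: measurable_adj_scale.
- apply: measurable_set_ler => //; apply: measurable_funM => //.
  by apply: measurable_empirical_var; exact: measurable_coord_diff.
- move=> t /=; rewrite /adj_scale lt_max (ltNge M kappa) kM orbF mul1r => M_lt.
  rewrite -(sqr_sqrtr (empirical_var_ge0 (coord_diff r k) t)).
  by rewrite ler_pXn2r ?nnegrE ?sqrtr_ge0// ltW.
Qed.

End score_selection.

(** * Weak indices *)

Section excess_mean.
Context (R : realType) (d : nat) (P : probability (d.-tuple R) R) (r : 'I_d).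

Definition excess k : R := meanv P k 0 - mu_min r P.

Lemma excess_attains0 : exists k, excess k = 0.
Proof.
rewrite /excess /mu_min; set mu := meanv P.
suff [k ->] : exists k, \big[Num.min/mu r 0]_(k < d) mu k 0 = mu k 0.
  by exists k; rewrite subrr.
elim/big_ind: _ => [|x y [j ->] [k ->]|k _]; [by exists r| |by exists k].
by rewrite minElt; case: ifP => _; [exists j|exists k].
Qed.

Lemma excess_attains0_neq : 0 < excess r -> exists2 k, k != r & excess k = 0.
Proof.
have [k k0] := excess_attains0; move=> r_gt0; exists k => //.
by apply: contraTneq r_gt0 => <-; rewrite k0 ltxx.
Qed.

Lemma excess_outside_confusion n (c : R) k : k != r -> 0 < excess r ->
  excess r / 2 <= excess k -> k \notin confusion_set n c r P ->
  c * Num.sqrt (ln d%:R / n%:R) < excess k.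
Proof.
move=> kr gap0 k_ge.
rewrite inE !negb_and kr negbK -!/(excess _) k_ge /= -ltNge.
case/orP => // /[!inE]; case/andP => _ /forallP k_min.
have [k0 k0r k0E] := excess_attains0_neq gap0.
have /implyP/(_ k0r) := k_min k0; move: k0E k_ge gap0; rewrite /excess; lra.
Qed.

(* The index [r] itself is weak as soon as [0 < excess r]. *)
Definition weak_index (c : R) k : bool := excess r - excess k < c * excess r.

End excess_mean.

Section chernoff_rate.
Context (R : realType) (d n : nat) (sigma : R).
Implicit Types a b : R.

Definition chernoff_rate a : R := n%:R * a ^+ 2 / (4 * sigma ^+ 2).

Lemma ler_chernoff_rate a b :
  0 <= a -> a <= b -> chernoff_rate a <= chernoff_rate b.
Proof.
move=> a0 ab; apply: ler_wpM2r; first by rewrite invr_ge0 mulr_ge0 ?sqr_ge0.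
by rewrite ler_wpM2l// ler_pXn2r ?nnegrE// (le_trans a0).
Qed.

Variables (P : probability (d.-tuple R) R) (r : 'I_d).
Hypotheses (n_gt0 : (0 < n)%N) (sigma_gt0 : 0 < sigma).
Hypothesis subP : subgaussian sigma P.

Let proxy_gt0 : 0 < 2 * sigma ^+ 2. Proof. by rewrite mulr_gt0 ?exprn_gt0. Qed.

Let rateE a : n%:R * a ^+ 2 / (2 * (2 * sigma ^+ 2)) = chernoff_rate a.
Proof. by rewrite /chernoff_rate mulrA -natrM. Qed.

Let meanE k : meanv P r 0 - meanv P k 0 = excess P r r - excess P r k.
Proof. by rewrite /excess; ring. Qed.

Lemma coord_diff_upper_tail k a : k != r -> 0 < a ->
  (iid P n [set t | a <= empirical_mean (coord_diff r k) t
                        - (excess P r r - excess P r k)]%R <=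
   (expR (- chernoff_rate a))%:E)%E.
Proof.
move=> kr a0; rewrite eq_sym in kr; rewrite -meanE -rateE.
have Pk := subgaussian_coord_diff subP kr.
exact: chernoff_empirical_mean proxy_gt0 Pk n_gt0 a0.
Qed.

Lemma coord_diff_lower_tail k a : k != r -> 0 < a ->
  (iid P n [set t | empirical_mean (coord_diff r k) t <=
                    (excess P r r - excess P r k) - a]%R <=
   (expR (- chernoff_rate a))%:E)%E.
Proof.
move=> kr a0; rewrite eq_sym in kr; rewrite -meanE -rateE.
have Pk := subgaussian_coord_diff subP kr.
exact: chernoff_empirical_mean_lower proxy_gt0 Pk n_gt0 a0.
Qed.

End chernoff_rate.

Section weak_indices.
Context (R : realType) (d n : nat) (sigma : R).
Variables (P : probability (d.-tuple R) R) (r : 'I_d) (c C q : R) (tau : nat).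
Local Notation excess := (excess P r).
Local Notation gap := (excess r).
Local Notation rate := (chernoff_rate n sigma).
Hypotheses (n_gt0 : (0 < n)%N) (sigma_gt0 : 0 < sigma).
Hypothesis subP : subgaussian sigma P.
Hypotheses (gap_gt0 : 0 < gap) (c_gt0 : 0 < c) (c_le : c <= 4^-1).

Let measurable_mean k :
  measurable_fun setT (@empirical_mean _ _ R (coord_diff r k) n).
Proof. by apply: measurable_empirical_mean; exact: measurable_coord_diff. Qed.

Lemma weak_excess_ge k : weak_index P r c k -> gap / 2 <= excess k.
Proof. by rewrite /weak_index; move: c_le gap_gt0 => *; nra. Qed.

(* A weak [k] needs a deviation of [2 c gap - (gap - a)] with [a := excess k]:
   at least [c a], since [a > (1 - c) gap] and [(1 - c)^2 >= 1 - 2 c]. *)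
Lemma weak_index_tail k : k != r -> weak_index P r c k ->
  (iid P n [set t | 2 * c * gap <= empirical_mean (coord_diff r k) t]%R <=
   (expR (- rate (c * excess k)))%:E)%E.
Proof.
move=> kr weak; have excess_gt0 : 0 < excess k.
  by apply: lt_le_trans (weak_excess_ge weak); rewrite divr_gt0.
have deviation : c * excess k <= 2 * c * gap - (gap - excess k).
  rewrite -subr_ge0; have -> : 2 * c * gap - (gap - excess k) - c * excess k =
    (1 - c) * (excess k - (1 - c) * gap) + c ^+ 2 * gap by ring.
  apply: addr_ge0; last exact: mulr_ge0 (sqr_ge0 c) (ltW gap_gt0).
  by apply: mulr_ge0; move: c_le weak; rewrite /weak_index; lra.
have mmean := measurable_mean k.
have ca_gt0 := mulr_gt0 c_gt0 excess_gt0.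
apply: le_trans (coord_diff_upper_tail n_gt0 sigma_gt0 subP kr ca_gt0).
apply: le_probability; [exact: measurable_set_ler| |by move=> t /=; lra].
by apply: measurable_set_ler => //; exact: measurable_funB.
Qed.

Hypotheses (q_ge1 : 1 <= q) (card_confusion : #|confusion_set n C r P| = tau).
Hypothesis (gap_rate : 2 * q * Num.max 1 (ln tau%:R) <= rate (c * (gap / 2))).
Hypothesis (confusion_rate : 2 * q <= (c * C) ^+ 2 / (4 * sigma ^+ 2)).
Hypothesis (C_ge0 : 0 <= C).

Let rate_ge k : weak_index P r c k ->
  2 * q * Num.max 1 (ln tau%:R) <= rate (c * excess k).
Proof.
move=> weak; apply: le_trans gap_rate _; apply: ler_chernoff_rate.
  by rewrite !mulr_ge0 ?(ltW c_gt0) ?(ltW gap_gt0) ?invr_ge0.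
by rewrite ler_pM2l ?weak_excess_ge.
Qed.

Lemma weak_rate_ge_card_confusion k :
  weak_index P r c k -> q + ln tau%:R <= rate (c * excess k).
Proof.
move=> /rate_ge; apply: le_trans; set L := Num.max _ _.
have L_ge1 : 1 <= L by rewrite le_max lexx.
have lnL : ln tau%:R <= L by rewrite le_max lexx orbT.
by move: q_ge1 => *; nra.
Qed.

Lemma weak_rate_outside_confusion k : k != r -> weak_index P r c k ->
  k \notin confusion_set n C r P -> q + ln d%:R <= rate (c * excess k).
Proof.
move=> kr weak k_out; have ln_d : 0 <= ln d%:R :> R.
  by rewrite ln_ge0// ler1n (leq_ltn_trans _ (ltn_ord r)).
have q_le : 2 * q <= rate (c * excess k).
  apply: le_trans (rate_ge weak); rewrite ler_peMr ?le_max ?lexx//.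
  by rewrite mulr_ge0// (le_trans _ q_ge1).
have ln_le : 2 * q * ln d%:R <= rate (c * excess k).
  have half_gap_le := weak_excess_ge weak.
  have cutoff := excess_outside_confusion kr gap_gt0 half_gap_le k_out.
  have cutoff_ge0 : 0 <= c * (C * Num.sqrt (ln d%:R / n%:R)).
    by rewrite !mulr_ge0 ?sqrtr_ge0 ?(ltW c_gt0).
  apply: (le_trans (ler_wpM2r ln_d confusion_rate)).
  rewrite (_ : _ * ln _ = rate (c * (C * Num.sqrt (ln d%:R / n%:R)))).
    by apply: ler_chernoff_rate => //; rewrite ler_pM2l// ltW.
  rewrite /chernoff_rate !exprMn sqr_sqrtr ?divr_ge0//.
  by field; rewrite !gt_eqF ?ltr0n.
by move: q_ge1 => *; nra.
Qed.

Lemma sum_weak_index_tail :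
  \sum_(k | (k != r) && weak_index P r c k) expR (- rate (c * excess k)) <=
  2 * expR (- q).
Proof.
rewrite (bigID (mem (confusion_set n C r P)))/= mulr_natl mulr2n; apply: lerD.
  apply: (sum_expRN_le (m := tau)) => [|k /andP[/andP[_ weak] _]].
    rewrite -card_confusion subset_leq_card//.
    by apply/fintype.subsetP => k /andP[].
  exact: weak_rate_ge_card_confusion.
apply: (sum_expRN_le (m := d)) => [|k /andP[/andP[kr weak]]].
  by rewrite -[leqRHS]card_ord max_card.
exact: weak_rate_outside_confusion.
Qed.

Lemma weak_index_uniform_tail :
  (iid P n [set t | exists2 k, (k != r) && weak_index P r c k &
                    2 * c * gap <= empirical_mean (coord_diff r k) t]%R <=
   (2 * expR (- q))%:E)%E.
Proof.
apply: (@le_trans _ _ (\sum_(k | (k != r) && weak_index P r c k)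
    iid P n [set t | 2 * c * gap <= empirical_mean (coord_diff r k) t]%R)%E).
  by apply: union_bound => k _; exact: measurable_set_ler.
have := sum_weak_index_tail; rewrite -lee_fin; apply: le_trans.
rewrite -sumEFin; apply: lee_sum => k /andP[kr weak_k].
exact: weak_index_tail.
Qed.

End weak_indices.

(** * Power *)

Section power.
Context (R : realType) (d n : nat) (sigma : R).
Variables (P : probability (d.-tuple R) R) (r : 'I_d).
Variables (kappa M eta C q : R) (tau : nat).
Variable D : 'I_d -> n.-tuple (d.-tuple R) -> R.
Let c := kappa / (4 * M).
Local Notation gap := (excess P r r).
Local Notation rate := (chernoff_rate n sigma).
Local Notation mean k := (empirical_mean (coord_diff r k)).
Local Notation weak := (weak_index P r c).
Hypotheses (n_gt1 : (1 < n)%N) (sigma_gt0 : 0 < sigma).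
Hypothesis subP : subgaussian sigma P.
Hypotheses (kappa_gt0 : 0 < kappa) (kappa_le : kappa <= M).
Hypotheses (mD : forall k, measurable_fun setT (D k)).
Hypotheses (D_ge : forall k t, kappa <= D k t).
Hypothesis D_le : forall k, k != r ->
  (iid P n [set t | M < D k t]%R <= eta%:E)%E.
Hypotheses (gap_gt0 : 0 < gap) (C_ge0 : 0 <= C) (q_ge1 : 1 <= q).
Hypothesis (card_confusion : #|confusion_set n C r P| = tau).
Hypothesis (gap_rate : 2 * q * Num.max 1 (ln tau%:R) <= rate (c * (gap / 2))).
Hypothesis (confusion_rate : 2 * q <= (c * C) ^+ 2 / (4 * sigma ^+ 2)).

Let n_gt0 : (0 < n)%N. Proof. exact: ltnW. Qed.
Let M_gt0 : 0 < M. Proof. exact: lt_le_trans kappa_le. Qed.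
Let c_gt0 : 0 < c. Proof. by rewrite divr_gt0 ?mulr_gt0. Qed.
Let c_le : c <= 4^-1.
Proof. by rewrite ler_pdivrMr ?mulr_gt0// mulrA mulVf// mul1r. Qed.
Let q_gt0 : 0 < q. Proof. exact: lt_le_trans q_ge1. Qed.
Let D_gt0 k t : 0 < D k t. Proof. exact: lt_le_trans (D_ge _ _). Qed.

Let half_gap_gt0 : 0 < gap / 2. Proof. by rewrite divr_gt0. Qed.
Let c_half_gap_ge0 : 0 <= c * (gap / 2).
Proof. exact: mulr_ge0 (ltW c_gt0) (ltW half_gap_gt0). Qed.

Let rate_half_gap : 2 * q <= rate (c * (gap / 2)).
Proof.
by apply: le_trans gap_rate; rewrite ler_peMr ?le_max ?lexx// mulr_ge0// ltW.
Qed.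

Let measurable_mean k :
  measurable_fun setT (@empirical_mean _ _ R (coord_diff r k) n).
Proof. by apply: measurable_empirical_mean; exact: measurable_coord_diff. Qed.

Let measurable_select k : measurable [set t | score_select r D t = k].
Proof. exact: measurable_score_select. Qed.

Let measurable_acceptance (z : R) k :
  measurable (studentized_acceptance z (coord_diff r k) (n := n)).
Proof.
by apply: measurable_studentized_acceptance; exact: measurable_coord_diff.
Qed.

Lemma selected_mean_ge t k0 : k0 != r -> D k0 t <= M -> gap / 2 <= mean k0 t ->
  2 * c * gap <= mean (score_select r D t) t.
Proof.
move=> k0r D_le_M mean_ge.
have := @sargmin_ratio_le _ _ r (fun k => - mean k t) (D^~ t) kappa M k0
  (D_gt0^~ t) (D_ge^~ t) k0r _ D_le_M.
rewrite oppr_le0 (le_trans (ltW half_gap_gt0) mean_ge) => /(_ isT).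
rewrite -/(score_select r D t) !mulrN lerN2 => ratio.
rewrite -(ler_pM2l M_gt0); apply: le_trans ratio.
rewrite (_ : M * _ = kappa * (gap / 2)); first by rewrite ler_pM2l.
by rewrite /c; field; rewrite gt_eqF.
Qed.

Lemma minimiser_small_mean_le k0 : k0 != r -> excess P r k0 = 0 ->
  (iid P n [set t | mean k0 t <= gap / 2]%R <= (expR (- q))%:E)%E.
Proof.
move=> k0r k0E.
have := coord_diff_lower_tail n_gt0 sigma_gt0 subP k0r half_gap_gt0.
rewrite k0E (_ : gap - 0 - gap / 2 = gap / 2); last by lra.
move=> /le_trans; apply; rewrite lee_fin ler_expR lerN2.
apply: (@le_trans _ _ (2 * q)); first by move: q_gt0; lra.
apply: le_trans rate_half_gap _; apply: ler_chernoff_rate => //.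
by rewrite ler_piMl// ?ltW//; move: c_le; lra.
Qed.

Lemma weak_select_le :
  (iid P n [set t | weak (score_select r D t)] <= (eta + 3 * expR (- q))%:E)%E.
Proof.
have [k0 k0r k0E] := excess_attains0_neq gap_gt0.
pose large_scale := [set t | M < D k0 t].
pose small_mean := [set t : n.-tuple (d.-tuple R) | mean k0 t <= gap / 2].
pose misleading := [set t : n.-tuple (d.-tuple R) |
  exists2 k, (k != r) && weak k & 2 * c * gap <= mean k t].
have mlarge_scale : measurable large_scale by exact: measurable_set_ltr.
have msmall_mean : measurable small_mean by exact: measurable_set_ler.
have mmisleading : measurable misleading.
  by apply: measurable_exists2 => k _; exact: measurable_set_ler.
rewrite (_ : 3 * expR (- q) = expR (- q) + 2 * expR (- q)); last by ring.
apply: (@probability_le_add _ _ _ _ _ large_scale (small_mean `|` misleading)).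
- exact: measurable_selection_pred.
- exact: mlarge_scale.
- exact: measurableU.
- move=> t /= weak_s; have [|D_le_M] := ltP M (D k0 t); [by left|right].
  have [|mean_gt] := leP (mean k0 t) (gap / 2); [by left|right].
  exists (score_select r D t); last exact: selected_mean_ge k0r D_le_M (ltW _).
  rewrite weak_s andbT.
  by have [] := sargmin_exceptP (fun k => - mean k t / D k t) k0r.
- exact: D_le.
apply: (@probability_le_add _ _ _ _ _ small_mean misleading) => //.
- exact: measurableU.
- exact: minimiser_small_mean_le.
- exact: (weak_index_uniform_tail n_gt0 sigma_gt0 subP gap_gt0 c_gt0 c_le q_ge1
    card_confusion gap_rate confusion_rate C_ge0).
Qed.

Lemma strong_acceptance_le z k : ~~ weak k ->
  (iid P n (studentized_acceptance z (coord_diff r k) (n := n)) <=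
   (type2_const z / (16 * q))%:E)%E.
Proof.
rewrite /weak_index -leNgt => strong; pose m := gap - excess P r k.
have m0 : 0 < m by apply: lt_le_trans strong; rewrite mulr_gt0.
have kr : r != k by apply: contraTneq m0 => rk; rewrite /m -rk subrr ltxx.
have v0 : 0 < 2 * sigma ^+ 2 by rewrite mulr_gt0 ?exprn_gt0.
have Pk := subgaussian_coord_diff subP kr.
rewrite (_ : _ - _ = m) in Pk; last by rewrite /m /excess; ring.
apply: le_trans (studentized_acceptance_le z v0 m0 n_gt1 Pk) _.
rewrite lee_fin -mulrA ler_wpM2l ?(ltW (type2_const_gt0 z))//.
rewrite ler_pdivrMr ?mulr_gt0 ?exprn_gt0 ?ltr0n//.
rewrite [leRHS]mulrC ler_pdivlMr ?mulr_gt0//.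
have : 2 * q <= rate (m / 2).
  apply: le_trans rate_half_gap _; apply: ler_chernoff_rate => //.
  by rewrite mulrA ler_pM2r.
rewrite /chernoff_rate ler_pdivlMr ?mulr_gt0 ?exprn_gt0// expr_div_n; lra.
Qed.

Lemma measurable_rejection alpha :
  measurable (rejection n alpha r (score_select r D \o @tuple_right _ _ n n)).
Proof.
rewrite -[X in measurable X]setCK rejection_setC; apply: measurableC.
exact: measurable_selected_event measurable_select (measurable_acceptance _).
Qed.

Lemma power_ge alpha (z := normal_quantile (1 - alpha)) :
  (1 - (eta + (3 + type2_const z / 16) / q)%:E <=
   iid P (n + n)
     (rejection n alpha r (score_select r D \o @tuple_right _ _ n n)))%E.
Proof.
set reject := rejection _ _ _ _.
have mreject : measurable reject by exact: measurable_rejection.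
have : (iid P (n + n) (~` reject) <=
    (eta + 3 * expR (- q) + type2_const z / (16 * q))%:E)%E.
  rewrite rejection_setC.
  have const_ge0 : 0 <= type2_const z / (16 * q).
    by rewrite divr_ge0 ?mulr_ge0 ?(ltW q_gt0)// ltW// type2_const_gt0.
  exact: (selected_event_le measurable_select (measurable_acceptance z)
    weak_select_le (@strong_acceptance_le z) const_ge0).
rewrite probability_setC//.
rewrite -(fineK (fin_num_measure (iid P (n + n)) _ mreject)).
rewrite -!EFinB !lee_fin (_ : _ / (16 * q) = type2_const z / 16 / q).
  by have := expRN_le_inv q_gt0; rewrite mulrDl; lra.
by rewrite invfM mulrA.
Qed.

End power.

Section asymptotic_power.
Context (R : realType).

Lemma cvg_inf_prob (d m : nat -> nat)
    (Cl : forall n, set (probability ((d n).-tuple R) R))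
    (A : forall n, set ((m n).-tuple ((d n).-tuple R))) :
  (forall n, measurable (A n)) ->
  (forall e : R, 0 < e -> \forall n \near \oo,
     forall P, Cl n P -> (1 - e%:E <= iid P (m n) (A n))%E) ->
  inf_prob (Cl n) (A n) @[n --> \oo] --> 1%E.
Proof.
move=> mA lbA.
have le1 n : (inf_prob (Cl n) (A n) <= 1)%E.
  rewrite /inf_prob; case: ifPn => // /set0P[P CP].
  apply: le_trans (probability_le1 (iid P (m n)) (mA n)).
  by apply: ereal_inf_lbound; exists P.
have ge0 n : (0 <= inf_prob (Cl n) (A n))%E.
  rewrite /inf_prob; case: ifPn => // _.
  by apply: le_ereal_inf_tmp => _ [P _ <-].
have fin n : inf_prob (Cl n) (A n) \is a fin_num.
  by rewrite ge0_fin_numE// (le_lt_trans (le1 n)) ?ltry.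
apply/fine_cvgP; split; first by apply: nearW => n; exact: fin.
apply/cvgrPdist_le => e e0; near=> n.
have ge_1Be : (1 - e%:E <= inf_prob (Cl n) (A n))%E.
  rewrite /inf_prob; case: ifPn => [_|_].
    by rewrite -EFinB lee_fin lerBlDr lerDl ltW.
  apply: le_ereal_inf_tmp => _ [P CP <-].
  by move: P CP; near: n; exact: lbA.
have := le1 n; move: ge_1Be => /=.
rewrite -{1 2}(fineK (fin n)) -EFinB !lee_fin.
by move=> lb ub; rewrite ger0_norm ?subr_ge0//; lra.
Unshelve. all: by end_near. Qed.

Lemma eps_star_gt0 n tau : (0 < n)%N -> 0 < eps_star R n tau.
Proof. by move=> n0; rewrite sqrtr_gt0 divr_gt0 ?ltr0n// lt_max ltr01. Qed.

Lemma chernoff_rate_eps_star (sigma c C' gap : R) n tau :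
  (0 < n)%N -> 0 < sigma -> 0 <= c -> 0 <= C' -> C' * eps_star R n tau <= gap ->
  (c * C') ^+ 2 / (16 * sigma ^+ 2) * Num.max 1 (ln tau%:R) <=
  chernoff_rate n sigma (c * (gap / 2)).
Proof.
move=> n0 sigma0 c0 C'0 gap_ge; set L := Num.max _ _.
have L_ge0 : 0 <= L by rewrite le_max ler01.
rewrite (_ : _ * L = chernoff_rate n sigma (c * (C' * eps_star R n tau / 2))).
  apply: ler_chernoff_rate; last by rewrite ler_wpM2l// ler_pM2r.
  by rewrite !mulr_ge0 ?invr_ge0 ?(ltW (eps_star_gt0 _ n0)).
rewrite /chernoff_rate !exprMn sqr_sqrtr ?divr_ge0// -/L.
by field; rewrite !gt_eqF ?ltr0n.
Qed.

Lemma near_chernoff_rate_eps_star (sigma c K : R) (C' : nat -> R)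
    (tau : nat -> nat) : 0 < sigma -> 0 < c ->
  (forall n, 0 < C' n) -> C' n @[n --> \oo] --> +oo ->
  \forall n \near \oo, forall gap, C' n * eps_star R n (tau n) <= gap ->
    K * Num.max 1 (ln (tau n)%:R) <= chernoff_rate n sigma (c * (gap / 2)).
Proof.
move=> sigma0 c0 C'0 C'_oo; near=> n => gap gap_ge.
have n0 : (0 < n)%N by near: n; exact: nbhs_infty_gt.
have := chernoff_rate_eps_star n0 sigma0 (ltW c0) (ltW (C'0 n)) gap_ge.
apply: le_trans; rewrite ler_wpM2r ?le_max ?ler01//.
rewrite ler_pdivlMr ?mulr_gt0 ?exprn_gt0//.
by near: n; exact: near_ge_sqr.
Unshelve. all: by end_near. Qed.

Definition uniformly_tight (sigma : R) (d : nat -> nat) (r : forall n, 'I_(d n))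
    (D : forall n, 'I_(d n) -> n.-tuple ((d n).-tuple R) -> R) : Prop :=
  forall e : R, 0 < e -> \forall M \near +oo,
    forall n (P : probability ((d n).-tuple R) R) k,
    (1 < n)%N -> subgaussian sigma P -> k != r n ->
    (iid P n [set t | M < D n k t]%R <= e%:E)%E.

Lemma uniformly_tight_cst (sigma b : R) d r :
  @uniformly_tight sigma d r (fun _ _ _ => b).
Proof.
move=> e e0; near=> M => n P k _ _ _.
rewrite (_ : mkset _ = set0) ?measure0 ?lee_fin ?ltW//.
have bM : b <= M by near: M; exact/nbhs_pinfty_ge/num_real.
by apply/seteqP; split=> t //=; rewrite ltNge bM.
Unshelve. all: by end_near. Qed.

Lemma uniformly_tight_adj_scale (sigma kappa : R) d r : 0 < sigma ->
  @uniformly_tight sigma d r (fun n => adj_scale (r n) kappa).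
Proof.
move=> sigma0 e e0; pose V := 16 * expR (1 / 2) * sigma ^+ 2.
near=> M => n P k n1 subP kr; rewrite eq_sym in kr.
have kM : kappa <= M by near: M; exact/nbhs_pinfty_ge/num_real.
have M1 : 1 <= M by near: M; exact: nbhs_pinfty_ge.
have VM : V / e <= M by near: M; exact/nbhs_pinfty_ge/num_real.
have M0 : 0 < M by exact: lt_le_trans M1.
apply: le_trans (adj_scale_tail sigma0 subP n1 kr kM M0) _.
rewrite -/V lee_fin ler_pdivrMr ?exprn_gt0// mulrC -ler_pdivrMr//.
by apply: le_trans VM _; rewrite expr2 ler_peMr// ltW.
Unshelve. all: by end_near. Qed.

Lemma score_select_power_cvg (alpha sigma kappa : R) (C C' eps : nat -> R)
    (d tau : nat -> nat) (r : forall n, 'I_(d n))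
    (D : forall n, 'I_(d n) -> n.-tuple ((d n).-tuple R) -> R)
    (s : forall n, (n + n).-tuple ((d n).-tuple R) -> 'I_(d n)) :
  0 < sigma -> 0 < kappa ->
  (forall n, 0 < C n) -> C n @[n --> \oo] --> +oo ->
  (forall n, 0 < C' n) -> C' n @[n --> \oo] --> +oo ->
  (forall n, C' n * eps_star R n (tau n) <= eps n) ->
  (forall n k, measurable_fun setT (D n k)) ->
  (forall n k t, kappa <= D n k t) ->
  uniformly_tight sigma r D ->
  (forall n, s n = score_select (r n) (D n) \o @tuple_right _ _ n n) ->
  inf_prob (alternatives n sigma (C n) (r n) (eps n) (tau n))
    (rejection n alpha (r n) (s n)) @[n --> \oo] --> 1%E.
Proof.
move=> sigma0 kappa0 C0 C_oo C'0 C'_oo eps_ge mD D_ge D_tight sE.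
apply: (@cvg_inf_prob d (fun n => n + n)%N) => [n|e e0].
  by rewrite sE; exact: measurable_rejection kappa0 (mD n) (D_ge n) _.
have half_e0 : 0 < e / 2 by rewrite divr_gt0.
have [M [kM D_leM]] :=
  filter_ex (filterI (nbhs_pinfty_ge (num_real kappa)) (D_tight _ half_e0)).
have M0 : 0 < M := lt_le_trans kappa0 kM.
pose c := kappa / (4 * M); have c0 : 0 < c by rewrite divr_gt0 ?mulr_gt0.
pose err := 3 + type2_const (normal_quantile (1 - alpha)) / 16.
have err0 : 0 < err by rewrite addr_gt0// divr_gt0// type2_const_gt0.
pose q := 1 + err / (e / 2); have q1 : 1 <= q by rewrite lerDl divr_ge0 ?ltW.
near=> n => P [subP gap_eps card_confusion].
have n1 : (1 < n)%N by near: n; exact: nbhs_infty_gt.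
have gap_ge := le_trans (eps_ge n) gap_eps.
have gap0 : 0 < excess P (r n) (r n).
  by apply: lt_le_trans gap_ge; rewrite mulr_gt0 ?eps_star_gt0// ltnW.
have gap_rate : forall gap, C' n * eps_star R n (tau n) <= gap ->
    2 * q * Num.max 1 (ln (tau n)%:R) <= chernoff_rate n sigma (c * (gap / 2)).
  by near: n; exact: near_chernoff_rate_eps_star.
have confusion_rate : 2 * q <= (c * C n) ^+ 2 / (4 * sigma ^+ 2).
  by rewrite ler_pdivlMr ?mulr_gt0 ?exprn_gt0//; near: n; exact: near_ge_sqr.
have := power_ge n1 sigma0 subP kappa0 kM (mD n) (D_ge n)
  (fun k => D_leM n P k n1 subP) gap0 (ltW (C0 n)) q1 card_confusion
  (gap_rate _ gap_ge) confusion_rate alpha.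
rewrite sE; apply: le_trans; rewrite -!EFinB lee_fin lerD2l lerN2 -/err.
suff : err / q <= e / 2 by lra.
rewrite ler_pdivrMr ?(lt_le_trans ltr01)// /q mulrDr mulr1.
rewrite [e / 2 * (err / _)]mulrC divfK ?gt_eqF//.
by rewrite lerDr ltW.
Unshelve. all: by end_near. Qed.

End asymptotic_power.

Theorem theorem3p1 (R : realType) (alpha sigma kappa : R)
  (halpha : 0 < alpha < 1) (hsigma : 0 < sigma) (hkappa : 0 < kappa)
  (C : nat -> R) (hC0 : forall n, 0 < C n) (hC : C n @[n --> \oo] --> +oo)
  (d : nat -> nat) (hd : forall n, (2 <= d n)%N) (r : forall n, 'I_(d n))
  (tau : nat -> nat) (htau : forall n, (tau n <= d n - 2)%N)
  (C' : nat -> R) (hC'0 : forall n, 0 < C' n) (hC' : C' n @[n --> \oo] --> +oo)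
  (eps : nat -> R) (heps0 : forall n, 0 < eps n)
  (heps : forall n, C' n * eps_star R n (tau n) <= eps n) :
  (inf_prob (alternatives n sigma (C n) (r n) (eps n) (tau n))
     (rejection n alpha (r n) (s_plug n (r n))) @[n --> \oo] --> 1%E) /\
  (inf_prob (alternatives n sigma (C n) (r n) (eps n) (tau n))
     (rejection n alpha (r n) (s_adj n kappa (r n))) @[n --> \oo] --> 1%E).
Proof.
split.
- apply: (score_select_power_cvg alpha hsigma ltr01 hC0 hC hC'0 hC' heps
    (D := fun _ _ _ => 1)) => // [|n]; first exact: uniformly_tight_cst.
  exact: s_plugE.
- apply: (score_select_power_cvg alpha hsigma hkappa hC0 hC hC'0 hC' heps
    (D := fun n => adj_scale (r n) kappa)) => [n k|n k t||n].
  + exact: measurable_adj_scale.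
  + exact: le_adj_scale.
  + exact: uniformly_tight_adj_scale.
  + exact: s_adjE.
Qed.
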